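(* Let $\Gamma$ be a quotient of a Kähler group $\pi_1(X)$ such that $\Gamma$ is a complex linear solvable group. Then there are two possibilities: either $\Gamma$ is deformable to a virtually nilpotent representation of $\pi_1(X)$, or $\pi_1(X)$ surjects onto the fundamental group of a curve of genus bigger than zero.
   Context: A Kähler group is the fundamental group $\pi_1(X)$ of a compact Kähler manifold $X$. A complex linear solvable group is a solvable group that is a subgroup of $GL_n(\mathbb{C})$ for some $n$. In the phrase ''$\Gamma$ is deformable'', $\Gamma$ stands for the representation $\rho:\pi_1(X)\to\Gamma\subset GL_n(\mathbb{C})$ given by the quotient homomorphism. ''Deformable'' has its ordinary meaning: $\rho$ can be moved through a family of representations of $\pi_1(X)$ to the other representation. A representation is virtually nilpotent if its image is a virtually nilpotent group, i.e. has a nilpotent subgroup of finite index. A curve here is a smooth connected compact complex curve. *)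

(* Defs.v *)
From HB Require Import structures.
From mathcomp Require Import all_boot all_order all_algebra.
From mathcomp Require Import all_classical all_reals all_analysis.
From mathcomp Require Import homotopy generic_quotient.
From mathcomp Require Import complex lra.
Import Order.TTheory GRing.Theory Num.Theory.
Import numFieldTopology.Exports numFieldNormedType.Exports.

Set Implicit Arguments.
Unset Strict Implicit.
Unset Printing Implicit Defensive.

Local Open Scope classical_set_scope.
Local Open Scope ring_scope.
Local Open Scope quotient_scope.

Definition unit_interval (R : realType) : Type := set_type [set` `[0 : R, 1]].

Section UnitInterval.
Variable R : realType.
Local Notation I := (unit_interval R).

HB.instance Definition _ := Topological.on I.

Definition ui_val (t : I) : R := set_val t.

Lemma ui_bounds (t : I) : 0 <= ui_val t <= 1.
Proof. by have := set_valP t; rewrite /= in_itv. Qed.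

Lemma ui_val_inj : injective ui_val.
Proof. exact: val_inj. Qed.

Lemma ui_val_continuous : continuous ui_val.
Proof. exact: initial_continuous. Qed.

Lemma ui_clamp_subproof (t : R) : Num.max 0 (Num.min t 1) \in [set` `[0 : R, 1]].
Proof.
rewrite mem_setE in_itv /= le_max lexx /= ge_max ler01 /=.
by rewrite ge_min lexx orbT.
Qed.

Definition ui_clamp (t : R) : I :=
  exist _ (Num.max 0 (Num.min t 1)) (ui_clamp_subproof t).

Lemma ui_val_clamp t : ui_val (ui_clamp t) = Num.max 0 (Num.min t 1).
Proof. by []. Qed.

Lemma ui_clampE t : 0 <= t <= 1 -> ui_val (ui_clamp t) = t.
Proof. by move=> /andP[t0 t1]; rewrite ui_val_clamp min_l // max_r. Qed.

Lemma ui_valK : cancel ui_val ui_clamp.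
Proof. by move=> t; apply: ui_val_inj; rewrite ui_clampE // ui_bounds. Qed.

Lemma ui_clamp_continuous : continuous ui_clamp.
Proof.
apply: continuous_comp_initial => t.
apply: (@continuous_max R R (fun=> 0) (fun t => Num.min t 1)).
  exact: cst_continuous.
apply: (@continuous_min R R idfun (fun=> 1)) => //.
exact: cst_continuous.
Qed.

Lemma ui_zero_one_neq : (ui_clamp 0 != ui_clamp 1)%B.
Proof.
apply/eqP => /(congr1 ui_val); rewrite !ui_clampE ?lexx ?ler01 //.
by move/eqP; rewrite eq_sym oner_eq0.
Qed.

HB.instance Definition _ := isBiPointed.Build I ui_zero_one_neq.

Lemma ui_val0 : ui_val (zero : I) = 0.
Proof. by rewrite ui_clampE ?lexx ?ler01. Qed.

Lemma ui_val1 : ui_val (one : I) = 1.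
Proof. by rewrite ui_clampE ?lexx ?ler01. Qed.

End UnitInterval.

Lemma continuous_paste (R : realType) (S T : topologicalType) (phi : S -> R)
    (c : R) (f g : S -> T) :
  continuous phi -> continuous f -> continuous g ->
  (forall s, phi s = c -> f s = g s) ->
  continuous (fun s => if phi s <= c then f s else g s).
Proof.
move=> cphi cf cg fg s /=.
case: (ltgtP (phi s) c) => phis.
- rewrite /continuous_at (ltW phis); apply: cvg_trans (cf s).
  apply: near_eq_cvg.
  have h : \forall u \near s, phi u < c := cphi s _ (lt_nbhsl phis).
  by near=> u; rewrite ifT //; apply/ltW; near: u.
- rewrite /continuous_at (leNgt (phi s)) phis; apply: cvg_trans (cg s).
  apply: near_eq_cvg.
  have h : \forall u \near s, c < phi u := cphi s _ (lt_nbhsr phis).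
  by near=> u; rewrite ifF //; apply/negbTE; rewrite -ltNge; near: u.
- move=> A; rewrite phis lexx => Af; have Ag : nbhs (g s) A by rewrite -fg.
  have hf : \forall u \near s, A (f u) := cf s _ Af.
  have hg : \forall u \near s, A (g u) := cg s _ Ag.
  change (\forall u \near s, A (if phi u <= c then f u else g u)).
  by near=> u; case: ifP => _; near: u.
Unshelve. all: by end_near. Qed.

Lemma cont_clamp (R : realType) (T S : topologicalType) (f : unit_interval R -> T) (phi : S -> R) :
  continuous f -> continuous phi -> continuous (fun s => f (ui_clamp (phi s))).
Proof.
move=> cf cphi s; apply: (@continuous_comp _ _ _ phi (f \o @ui_clamp R)).
  exact: cphi.
by apply: continuous_comp; [exact: ui_clamp_continuous|exact: cf].
Qed.

Lemma cont_clampI (R : realType) (S : topologicalType) (phi : S -> R) :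
  continuous phi -> continuous (fun s => ui_clamp (phi s)).
Proof. by move=> cphi; apply: (@cont_clamp R _ S idfun) => // t; exact: cvg_id. Qed.

Lemma cont_affine (R : realType) (S : topologicalType) (phi : S -> R) (a b : R) :
  continuous phi -> continuous (fun s => a * phi s + b).
Proof.
move=> cphi s; rewrite /continuous_at; apply: cvgD; last exact: cvg_cst.
by apply: cvgM; [exact: cvg_cst|exact: cphi].
Qed.

Section PathHomotopy.
Variables (R : realType) (T : topologicalType).
Local Notation I := (unit_interval R).

Definition path_homotopic (x y : T) (p q : {path I from x to y}) : Prop :=
  exists H : I * I -> T,
    [/\ continuous H,
        (forall t, H (zero, t) = p t), (forall t, H (one, t) = q t),
        (forall s, H (s, zero) = x) & (forall s, H (s, one) = y)].

Lemma cont_fst_val : continuous (fun st : I * I => ui_val st.1).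
Proof.
move=> st; apply: (@continuous_comp _ _ _ fst (@ui_val R)).
  exact: cvg_fst.
exact: ui_val_continuous.
Qed.

Lemma cont_snd_val : continuous (fun st : I * I => ui_val st.2).
Proof.
move=> st; apply: (@continuous_comp _ _ _ snd (@ui_val R)).
  exact: cvg_snd.
exact: ui_val_continuous.
Qed.

Lemma cont_pair (S U V : topologicalType) (f : S -> U) (g : S -> V) :
  continuous f -> continuous g -> continuous (fun s => (f s, g s)).
Proof. by move=> cf cg s; apply: cvg_pair; [exact: cf|exact: cg]. Qed.

Lemma reparam_homotopic (x y : T) (f : I -> T) (phi psi : I -> R)
    (p q : {path I from x to y}) :
  continuous f -> continuous phi -> continuous psi ->
  phi zero = psi zero -> phi one = psi one ->
  (forall t, p t = f (ui_clamp (phi t))) ->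
  (forall t, q t = f (ui_clamp (psi t))) -> path_homotopic p q.
Proof.
move=> cf cphi cpsi e0 e1 pE qE.
exists (fun st : I * I => f (ui_clamp
  ((1 - ui_val st.1) * phi st.2 + ui_val st.1 * psi st.2))); split.
- apply: cont_clamp cf _ => st.
  have c1 : {for st, continuous (fun st : I * I => ui_val st.1)}.
    exact: cont_fst_val.
  have c2 (h : I -> R) : continuous h -> {for st, continuous (fun st : I * I => h st.2)}.
    move=> ch; apply: (@continuous_comp _ _ _ snd h); first exact: cvg_snd.
    exact: ch.
  apply: cvgD; apply: cvgM; [|exact: c2| |exact: c2] => //.
  by apply: cvgB => //; exact: cvg_cst.
- by move=> t; rewrite /= ui_val0 subr0 mul1r mul0r addr0.
- by move=> t; rewrite /= ui_val1 subrr mul1r mul0r add0r.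
- move=> s /=; rewrite -e0 -mulrDl subrK mul1r -pE; exact: path_zero.
- move=> s /=; rewrite -e1 -mulrDl subrK mul1r -pE; exact: path_one.
Qed.

Lemma path_homotopic_refl x y (p : {path I from x to y}) : path_homotopic p p.
Proof.
apply: (@reparam_homotopic _ _ p (@ui_val R) (@ui_val R)) => //; 
  try exact: ui_val_continuous; try by move=> t; rewrite ui_valK.
exact: cts_fun.
Qed.

Lemma path_homotopic_sym x y (p q : {path I from x to y}) :
  path_homotopic p q -> path_homotopic q p.
Proof.
case=> H [cH H0 H1 Hx Hy].
exists (fun st => H (ui_clamp ((-1) * ui_val st.1 + 1), st.2)); split => //=.
- move=> st; apply: (@continuous_comp _ _ _
    (fun st : I * I => (ui_clamp ((-1) * ui_val st.1 + 1), st.2)) H).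
    apply: cont_pair => [|{}st]; last exact: cvg_snd.
    apply: cont_clampI.
    by apply: cont_affine; exact: cont_fst_val.
  exact: cH.
- by move=> t; rewrite ui_val0 mulr0 add0r.
- by move=> t; rewrite ui_val1 mulr1 addrC subrr.
Qed.

Lemma path_homotopic_trans x y (p q r : {path I from x to y}) :
  path_homotopic p q -> path_homotopic q r -> path_homotopic p r.
Proof.
case=> H [cH H0 H1 Hx Hy] [K [cK K0 K1 Kx Ky]].
have cgen (G : I * I -> T) (a b : R) : continuous G ->
    continuous (fun st : I * I => G (ui_clamp (a * ui_val st.1 + b), st.2)).
  move=> cG st; apply: (@continuous_comp _ _ _
    (fun st : I * I => (ui_clamp (a * ui_val st.1 + b), st.2)) G); last exact: cG.
  apply: cont_pair => [|{}st]; last exact: cvg_snd.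
  apply: cont_clampI.
  by apply: cont_affine; exact: cont_fst_val.
exists (fun st => if ui_val st.1 <= 2^-1
   then H (ui_clamp (2 * ui_val st.1 + 0), st.2)
   else K (ui_clamp (2 * ui_val st.1 + -1), st.2)); split => /=.
- apply: continuous_paste; [exact: cont_fst_val|exact: cgen|exact: cgen|].
  move=> [s t] /= ->; rewrite mulfV ?pnatr_eq0 // addr0 subrr.
  by rewrite -[ui_clamp 1]/(one : I) -[ui_clamp 0]/(zero : I) H1 K0.
- move=> t; rewrite ui_val0 invr_ge0 ler0n mulr0 addr0.
  by rewrite -[ui_clamp 0]/(zero : I) H0.
- move=> t; rewrite ui_val1 ifF; last by apply/negbTE; rewrite -ltNge; lra.
  rewrite mulr1 (_ : 2 - 1 = 1 :> R); last by lra.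
  by rewrite -[ui_clamp 1]/(one : I) K1.
- by move=> s; rewrite Hx Kx if_same.
- by move=> s; rewrite Hy Ky if_same.
Qed.

Definition concat_fun (p q : I -> T) (t : I) : T :=
  if ui_val t <= 2^-1 then p (ui_clamp (2 * ui_val t))
  else q (ui_clamp (2 * ui_val t - 1)).

Definition path_inv_fun (p : I -> T) (t : I) : T := p (ui_clamp (1 - ui_val t)).

Section Concat.
Variables (x y z : T) (p : {path I from x to y}) (q : {path I from y to z}).

Lemma concat_cts : continuous (concat_fun p q).
Proof.
apply: continuous_paste; first exact: ui_val_continuous.
- apply: cont_clamp; first exact: cts_fun.
  move=> t; have := @cont_affine R I _ 2 0 (@ui_val_continuous R) t.
  by under eq_fun do rewrite addr0.
- apply: cont_clamp; first exact: cts_fun.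
  by apply: cont_affine; exact: ui_val_continuous.
- move=> t ->; rewrite mulfV ?pnatr_eq0 // subrr.
  rewrite -[ui_clamp 1]/(one : I) -[ui_clamp 0]/(zero : I).
  by rewrite path_one path_zero.
Qed.

Lemma concat0 : concat_fun p q zero = x.
Proof.
rewrite /concat_fun ui_val0 invr_ge0 ler0n mulr0.
by rewrite -[ui_clamp 0]/(zero : I) path_zero.
Qed.

Lemma concat1 : concat_fun p q one = z.
Proof.
rewrite /concat_fun ui_val1 ifF; last by apply/negbTE; rewrite -ltNge; lra.
rewrite mulr1 (_ : 2 - 1 = 1 :> R); last by lra.
by rewrite -[ui_clamp 1]/(one : I) path_one.
Qed.

Definition path_concat : {path I from x to z} := mk_path concat_cts concat0 concat1.

Lemma path_inv_cts : continuous (path_inv_fun p).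
Proof.
apply: cont_clamp; first exact: cts_fun.
move=> t; have := @cont_affine R I _ (-1) 1 (@ui_val_continuous R) t.
by under eq_fun do rewrite mulN1r addrC.
Qed.

Lemma path_inv0 : path_inv_fun p zero = y.
Proof.
by rewrite /path_inv_fun ui_val0 subr0 -[ui_clamp 1]/(one : I) path_one.
Qed.

Lemma path_inv1 : path_inv_fun p one = x.
Proof.
by rewrite /path_inv_fun ui_val1 subrr -[ui_clamp 0]/(zero : I) path_zero.
Qed.

Definition path_inv : {path I from y to x} := mk_path path_inv_cts path_inv0 path_inv1.

End Concat.

Lemma cst_cts (x : T) : continuous (fun _ : I => x).
Proof. by move=> t; exact: cst_continuous. Qed.

Definition path_cst (x : T) : {path I from x to x} :=
  mk_path (@cst_cts x) erefl erefl.

Lemma concat_homotopic x y z (p p' : {path I from x to y})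
    (q q' : {path I from y to z}) :
  path_homotopic p p' -> path_homotopic q q' ->
  path_homotopic (path_concat p q) (path_concat p' q').
Proof.
case=> H [cH H0 H1 Hx Hy] [K [cK K0 K1 Kx Ky]].
have cgen (G : I * I -> T) (a b : R) : continuous G ->
    continuous (fun st : I * I => G (st.1, ui_clamp (a * ui_val st.2 + b))).
  move=> cG st; apply: (@continuous_comp _ _ _
    (fun st : I * I => (st.1, ui_clamp (a * ui_val st.2 + b))) G); last exact: cG.
  apply: cont_pair => [{}st|]; first exact: cvg_fst.
  apply: cont_clampI.
  by apply: cont_affine; exact: cont_snd_val.
exists (fun st => if ui_val st.2 <= 2^-1
   then H (st.1, ui_clamp (2 * ui_val st.2 + 0))
   else K (st.1, ui_clamp (2 * ui_val st.2 + -1))); split => /=.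
- apply: continuous_paste; [exact: cont_snd_val|exact: cgen|exact: cgen|].
  move=> [s t] /= ->; rewrite mulfV ?pnatr_eq0 // addr0 subrr.
  by rewrite -[ui_clamp 1]/(one : I) -[ui_clamp 0]/(zero : I) Hy Kx.
- by move=> t; rewrite H0 K0 addr0.
- by move=> t; rewrite H1 K1 addr0.
- move=> s; rewrite ui_val0 invr_ge0 ler0n mulr0 addr0.
  by rewrite -[ui_clamp 0]/(zero : I) Hx.
- move=> s; rewrite ui_val1 ifF; last by apply/negbTE; rewrite -ltNge; lra.
  rewrite mulr1 (_ : 2 - 1 = 1 :> R); last by lra.
  by rewrite -[ui_clamp 1]/(one : I) Ky.
Qed.

Lemma inv_homotopic x y (p q : {path I from x to y}) :
  path_homotopic p q -> path_homotopic (path_inv p) (path_inv q).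
Proof.
case=> H [cH H0 H1 Hx Hy].
exists (fun st => H (st.1, ui_clamp (1 - ui_val st.2))); split => /=.
- move=> st; apply: (@continuous_comp _ _ _
    (fun st : I * I => (st.1, ui_clamp (1 - ui_val st.2))) H); last exact: cH.
  apply: cont_pair => [{}st|]; first exact: cvg_fst.
  apply: cont_clampI => {}st.
  have := @cont_affine R _ _ (-1) 1 cont_snd_val st.
  by under eq_fun do rewrite mulN1r addrC.
- by move=> t; rewrite H0.
- by move=> t; rewrite H1.
- by move=> s; rewrite ui_val0 subr0 -[ui_clamp 1]/(one : I) Hy.
- by move=> s; rewrite ui_val1 subrr -[ui_clamp 0]/(zero : I) Hx.
Qed.

Lemma cont_ui_affine (a b : R) : continuous (fun t : I => a * ui_val t + b).
Proof. by apply: cont_affine; exact: ui_val_continuous. Qed.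

Lemma cont_maxr (f g : I -> R) : continuous f -> continuous g ->
  continuous (fun t => Num.max (f t) (g t)).
Proof. by move=> cf cg t; exact: (@continuous_max R I f g t (cf t) (cg t)). Qed.

Lemma cont_minr (f g : I -> R) : continuous f -> continuous g ->
  continuous (fun t => Num.min (f t) (g t)).
Proof. by move=> cf cg t; exact: (@continuous_min R I f g t (cf t) (cg t)). Qed.

Lemma concat_clamp (p q : I -> T) u : 0 <= u <= 1 ->
  concat_fun p q (ui_clamp u) =
    if u <= 2^-1 then p (ui_clamp (2 * u)) else q (ui_clamp (2 * u - 1)).
Proof. by move=> u01; rewrite /concat_fun ui_clampE. Qed.

Lemma concatA_homotopic x y z w (p : {path I from x to y})
    (q : {path I from y to z}) (r : {path I from z to w}) :
  path_homotopic (path_concat p (path_concat q r))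
                 (path_concat (path_concat p q) r).
Proof.
apply: (@reparam_homotopic _ _ (path_concat (path_concat p q) r)
  (fun t => Num.max (2^-1 * ui_val t + 0)
     (Num.max (1 * ui_val t + - 4^-1) (2 * ui_val t + -1))) (@ui_val R)).
- exact: cts_fun.
- by do 2?apply: cont_maxr; exact: cont_ui_affine.
- exact: ui_val_continuous.
- rewrite ui_val0; rewrite max_l //; rewrite ?ge_max; lra.
- rewrite ui_val1; rewrite max_r; rewrite ?max_r ?le_max; lra.
- move=> t; have /andP[t0 t1] := ui_bounds t.
  rewrite /= /mk_path /=; rewrite [LHS]/concat_fun.
  case: (leP (ui_val t) 2^-1) => t2.
    rewrite max_l; last by rewrite ge_max; lra.
    rewrite addr0 concat_clamp; last by lra.
    rewrite ifT; last by lra.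
    rewrite mulrA mulfV ?pnatr_eq0 // mul1r concat_clamp; last by lra.
    by rewrite t2.
  rewrite concat_clamp; last by lra.
  case: (leP (2 * ui_val t - 1) 2^-1) => t3.
    rewrite max_r; last by rewrite le_max; lra.
    rewrite max_l; last by lra.
    rewrite concat_clamp; last by lra.
    rewrite ifT; last by lra.
    rewrite concat_clamp; last by lra.
    rewrite ifF; last by apply/negbTE; rewrite -ltNge; lra.
    by congr (_ (ui_clamp _)); lra.
  rewrite max_r; last by rewrite le_max; lra.
  rewrite max_r; last by lra.
  rewrite concat_clamp; last by lra.
  rewrite ifF; last by apply/negbTE; rewrite -ltNge; lra.
  by congr (_ (ui_clamp _)); lra.
- by move=> t; rewrite ui_valK.
Qed.

Lemma concat_cstl_homotopic x y (p : {path I from x to y}) :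
  path_homotopic (path_concat (path_cst x) p) p.
Proof.
apply: (@reparam_homotopic _ _ p
  (fun t => Num.max (0 * ui_val t + 0) (2 * ui_val t + -1)) (@ui_val R)).
- exact: cts_fun.
- by apply: cont_maxr; exact: cont_ui_affine.
- exact: ui_val_continuous.
- rewrite ui_val0; rewrite max_l //; lra.
- rewrite ui_val1; rewrite max_r; lra.
- move=> t; have /andP[t0 t1] := ui_bounds t.
  rewrite /= /mk_path /= [LHS]/concat_fun; case: (leP (ui_val t) 2^-1) => t2.
    rewrite max_l; last by lra.
    by rewrite mul0r addr0 -[ui_clamp 0]/(zero : I) path_zero.
  by rewrite max_r //; lra.
- by move=> t; rewrite ui_valK.
Qed.

Lemma concat_cstr_homotopic x y (p : {path I from x to y}) :
  path_homotopic (path_concat p (path_cst y)) p.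
Proof.
apply: (@reparam_homotopic _ _ p
  (fun t => Num.min (2 * ui_val t + 0) (0 * ui_val t + 1)) (@ui_val R)).
- exact: cts_fun.
- by apply: cont_minr; exact: cont_ui_affine.
- exact: ui_val_continuous.
- rewrite ui_val0; rewrite min_l //; lra.
- rewrite ui_val1; rewrite min_r; lra.
- move=> t; have /andP[t0 t1] := ui_bounds t.
  rewrite /= /mk_path /= [LHS]/concat_fun; case: (leP (ui_val t) 2^-1) => t2.
    by rewrite min_l ?addr0 //; lra.
  rewrite min_r; last by lra.
  by rewrite mul0r add0r -[ui_clamp 1]/(one : I) path_one.
- by move=> t; rewrite ui_valK.
Qed.

Lemma concat_invr_homotopic x y (p : {path I from x to y}) :
  path_homotopic (path_concat p (path_inv p)) (path_cst x).
Proof.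
apply: (@reparam_homotopic _ _ p
  (fun t => Num.min (2 * ui_val t + 0) ((-2) * ui_val t + 2))
  (fun t => 0 * ui_val t + 0)).
- exact: cts_fun.
- by apply: cont_minr; exact: cont_ui_affine.
- exact: cont_ui_affine.
- rewrite ui_val0; rewrite min_l //; lra.
- rewrite ui_val1; rewrite min_r; lra.
- move=> t; have /andP[t0 t1] := ui_bounds t.
  rewrite /= /mk_path /= [LHS]/concat_fun; case: (leP (ui_val t) 2^-1) => t2.
    by rewrite min_l ?addr0 //; lra.
  rewrite min_r; last by lra.
  rewrite /path_inv_fun ui_clampE; last by lra.
  by congr (_ (ui_clamp _)); lra.
- by move=> t; rewrite mul0r addr0 -[ui_clamp 0]/(zero : I) path_zero.
Qed.

Lemma concat_invl_homotopic x y (p : {path I from x to y}) :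
  path_homotopic (path_concat (path_inv p) p) (path_cst y).
Proof.
apply: (@reparam_homotopic _ _ p
  (fun t => Num.max ((-2) * ui_val t + 1) (2 * ui_val t + -1))
  (fun t => 0 * ui_val t + 1)).
- exact: cts_fun.
- by apply: cont_maxr; exact: cont_ui_affine.
- exact: cont_ui_affine.
- rewrite ui_val0; rewrite max_l //; lra.
- rewrite ui_val1; rewrite max_r; lra.
- move=> t; have /andP[t0 t1] := ui_bounds t.
  rewrite /= /mk_path /= [LHS]/concat_fun; case: (leP (ui_val t) 2^-1) => t2.
    rewrite max_l; last by lra.
    rewrite /path_inv_fun ui_clampE; last by lra.
    by congr (_ (ui_clamp _)); lra.
  by rewrite max_r //; lra.
- by move=> t; rewrite mul0r add0r -[ui_clamp 1]/(one : I) path_one.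
Qed.

End PathHomotopy.

Section FundamentalGroup.
Variables (R : realType) (T : topologicalType) (x : T).
Local Notation I := (unit_interval R).
Local Notation loop := {path I from x to x}.

Definition loop_homotopicb (p q : loop) : bool := `[< path_homotopic p q >].

Lemma loop_homotopicb_refl : reflexive loop_homotopicb.
Proof. by move=> p; apply/asboolP; exact: path_homotopic_refl. Qed.

Lemma loop_homotopicb_sym : symmetric loop_homotopicb.
Proof.
by move=> p q; apply/asboolP/asboolP; exact: path_homotopic_sym.
Qed.

Lemma loop_homotopicb_trans : transitive loop_homotopicb.
Proof.
move=> q p r /asboolP pq /asboolP qr; apply/asboolP.
exact: path_homotopic_trans pq qr.
Qed.

Canonical loop_homotopy_equiv := EquivRel loop_homotopicb
  loop_homotopicb_refl loop_homotopicb_sym loop_homotopicb_trans.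

Definition fundamental_group : Type := {eq_quot loop_homotopicb}.
HB.instance Definition _ := Choice.on fundamental_group.

Definition loop_class (p : loop) : fundamental_group := \pi_({eq_quot loop_homotopicb}) p.

Lemma loop_classP p q : loop_class p = loop_class q <-> path_homotopic p q.
Proof.
split=> [/eqmodP/asboolP //|pq].
by apply/eqmodP/asboolP.
Qed.

Definition loop_repr (a : fundamental_group) : loop := repr (a : {eq_quot loop_homotopicb}).

Lemma loop_reprK a : loop_class (loop_repr a) = a.
Proof. exact: (@reprK _ {eq_quot loop_homotopicb}). Qed.

Lemma loop_classK p : path_homotopic (loop_repr (loop_class p)) p.
Proof. by apply/loop_classP; rewrite loop_reprK. Qed.

Definition pi1_mul (a b : fundamental_group) : fundamental_group :=
  loop_class (path_concat (loop_repr a) (loop_repr b)).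
Definition pi1_inv (a : fundamental_group) : fundamental_group := loop_class (path_inv (loop_repr a)).
Definition pi1_one : fundamental_group := loop_class (path_cst R x).

Lemma loop_classM p q :
  loop_class (path_concat p q) = pi1_mul (loop_class p) (loop_class q).
Proof.
apply/loop_classP/path_homotopic_sym.
by apply: concat_homotopic; exact: loop_classK.
Qed.

Lemma loop_classV p : loop_class (path_inv p) = pi1_inv (loop_class p).
Proof.
by apply/loop_classP/path_homotopic_sym/inv_homotopic; exact: loop_classK.
Qed.

Lemma pi1_mulA : associative pi1_mul.
Proof.
move=> a b c; rewrite -(loop_reprK a) -(loop_reprK b) -(loop_reprK c).
by rewrite -!loop_classM; apply/loop_classP; exact: concatA_homotopic.
Qed.

Lemma pi1_mul1g : left_id pi1_one pi1_mul.
Proof.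
move=> a; rewrite -(loop_reprK a) -loop_classM.
by apply/loop_classP; exact: concat_cstl_homotopic.
Qed.

Lemma pi1_mulg1 : right_id pi1_one pi1_mul.
Proof.
move=> a; rewrite -(loop_reprK a) -loop_classM.
by apply/loop_classP; exact: concat_cstr_homotopic.
Qed.

Lemma pi1_mulVg : left_inverse pi1_one pi1_inv pi1_mul.
Proof.
move=> a; rewrite -(loop_reprK a) -loop_classV -loop_classM.
by apply/loop_classP; exact: concat_invl_homotopic.
Qed.

Lemma pi1_mulgV : right_inverse pi1_one pi1_inv pi1_mul.
Proof.
move=> a; rewrite -(loop_reprK a) -loop_classV -loop_classM.
by apply/loop_classP; exact: concat_invr_homotopic.
Qed.

HB.instance Definition _ := isGroup.Build fundamental_group
  pi1_mulA pi1_mul1g pi1_mulg1 pi1_mulVg pi1_mulgV.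

End FundamentalGroup.

Arguments fundamental_group R {T} x.

Section GroupNotions.
Variable G : groupType.
Local Open Scope group_scope.
Implicit Types A B H N : set G.

Definition is_subgroup H : Prop :=
  [/\ H 1, (forall x y, H x -> H y -> H (x * y)) & (forall x, H x -> H x^-1)].

Definition commutator_subgroup A B : set G :=
  smallest is_subgroup [set commg a b | a in A & b in B].

Definition is_solvable H : Prop :=
  exists k : nat, iter k (fun K => commutator_subgroup K K) H = [set 1].

Definition is_nilpotent H : Prop :=
  exists k : nat, iter k (fun K => commutator_subgroup K H) H = [set 1].

Definition finite_index H N : Prop :=
  finite_set [set [set x * y | y in N] | x in H].

Definition virtually_nilpotent H : Prop :=
  exists N : set G,
    [/\ is_subgroup N, N `<=` H, finite_index H N & is_nilpotent N].

End GroupNotions.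

(* The complex numbers over R. The topological and normed structures of
   MathComp-Analysis are attached to a generic numFieldType, and are not found
   on R[i] itself. *)
Definition Cplx (R : realType) : numClosedFieldType := R[i].

Definition of_real {R : realType} (t : R) : Cplx R := (t%:C)%C.

Section GeneralLinear.
Variables (F : fieldType) (n : nat).

Record GL := MkGL { GL_mx :> 'M[F]_n; GL_unit : GL_mx \in unitmx }.

HB.instance Definition _ := [isSub for GL_mx].
HB.instance Definition _ := [Choice of GL by <:].

Lemma GL_mul_subproof (A B : GL) : A *m B \in unitmx.
Proof. by rewrite unitmx_mul !GL_unit. Qed.

Lemma GL_inv_subproof (A : GL) : invmx A \in unitmx.
Proof. by rewrite unitmx_inv GL_unit. Qed.

Definition GL_one : GL := MkGL (unitmx1 F n).
Definition GL_mul (A B : GL) : GL := MkGL (GL_mul_subproof A B).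
Definition GL_inv (A : GL) : GL := MkGL (GL_inv_subproof A).

Lemma GL_mulA : associative GL_mul.
Proof. by move=> A B D; apply: val_inj; rewrite /= mulmxA. Qed.
Lemma GL_mul1g : left_id GL_one GL_mul.
Proof. by move=> A; apply: val_inj; rewrite /= mul1mx. Qed.
Lemma GL_mulg1 : right_id GL_one GL_mul.
Proof. by move=> A; apply: val_inj; rewrite /= mulmx1. Qed.
Lemma GL_mulVg : left_inverse GL_one GL_inv GL_mul.
Proof. by move=> A; apply: val_inj; rewrite /= mulVmx ?GL_unit. Qed.
Lemma GL_mulgV : right_inverse GL_one GL_inv GL_mul.
Proof. by move=> A; apply: val_inj; rewrite /= mulmxV ?GL_unit. Qed.

HB.instance Definition _ :=
  isGroup.Build GL GL_mulA GL_mul1g GL_mulg1 GL_mulVg GL_mulgV.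

End GeneralLinear.

Section Representations.
Variables (R : realType) (G : groupType) (n : nat).

Definition representation : Type := {multiplicative G -> GL (Cplx R) n}.

(* Hom(G, GL_n(C)) carries the topology of pointwise convergence; a deformation
   is a path in it. *)
Definition deformable_to (rho sigma : representation) : Prop :=
  exists F : unit_interval R -> representation,
    [/\ F zero =1 rho, F one =1 sigma &
        forall g : G, continuous (fun t => F t g : 'M[Cplx R]_n)].

Definition virtually_nilpotent_rep (sigma : representation) : Prop :=
  virtually_nilpotent (range sigma).

End Representations.

Section ComplexManifold.
Variables (R : realType) (d : nat).
Local Notation C := (Cplx R).

Definition holomorphic_on (m k : nat) (U : set 'rV[C]_d)
    (f : 'rV[C]_d -> 'M[C]_(m, k)) :
    Prop :=
  forall z, U z -> differentiable f z.

Record complex_manifold : Type := ComplexManifold {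
  cm_space :> topologicalType;
  cm_hausdorff : hausdorff_space cm_space;
  cm_index : Type;
  cm_dom : cm_index -> set cm_space;
  cm_chart : cm_index -> cm_space -> 'rV[C]_d;
  cm_param : cm_index -> 'rV[C]_d -> cm_space;
  cm_dom_open : forall i, open (cm_dom i);
  cm_dom_cover : forall x, exists i, cm_dom i x;
  cm_image_open : forall i, open (cm_chart i @` cm_dom i);
  cm_chartK : forall i x, cm_dom i x -> cm_param i (cm_chart i x) = x;
  cm_chart_continuous : forall i, {within cm_dom i, continuous (cm_chart i)};
  cm_param_continuous :
    forall i, {within cm_chart i @` cm_dom i, continuous (cm_param i)};
  cm_transition_holomorphic : forall i j,
    holomorphic_on (cm_chart i @` (cm_dom i `&` cm_dom j))
                   (cm_chart j \o cm_param i)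
}.

Definition cm_image (X : complex_manifold) (i : cm_index X) : set 'rV[C]_d :=
  cm_chart i @` cm_dom i.

Definition cm_transition (X : complex_manifold) (i j : cm_index X) :
    'rV[C]_d -> 'rV[C]_d :=
  cm_chart j \o cm_param i.

Definition cm_overlap (X : complex_manifold) (i j : cm_index X) : set 'rV[C]_d :=
  cm_chart i @` (cm_dom i `&` cm_dom j).

Definition real_line (f : 'rV[C]_d -> R) (z v : 'rV[C]_d) (t : R) : R :=
  f (z + of_real t *: v).

Definition real_deriv (v : 'rV[C]_d) (f : 'rV[C]_d -> R) (z : 'rV[C]_d) : R :=
  derive1 (real_line f z v) 0.

(* C^k in the real sense, on an open set U of C^d = R^(2d). *)
Fixpoint Ck_on (k : nat) (U : set 'rV[C]_d) (f : 'rV[C]_d -> R) : Prop :=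
  (forall z, U z -> {for z, continuous f}) /\
  (if k is k'.+1 then
     forall v : 'rV[C]_d,
       (forall z, U z -> derivable (real_line f z v) 0 1) /\
       Ck_on k' U (real_deriv v f)
   else True).

Definition smooth_on (U : set 'rV[C]_d) (f : 'rV[C]_d -> R) : Prop :=
  forall k, Ck_on k U f.

(* A Kaehler form, i.e. a smooth closed positive real (1,1)-form, given by its
   local expressions omega i z on the tangent space C^d of the chart i.
   kf_J is the type condition and kf_pos says that (u, v) |-> omega (u, Jv) is
   a Riemannian metric, J being the multiplication by 'i. In kf_closed the
   exterior derivative is evaluated on constant vector fields. *)
Record kahler_form (X : complex_manifold) : Type := KahlerForm {
  kf_form : cm_index X -> 'rV[C]_d -> 'rV[C]_d -> 'rV[C]_d -> R;
  kf_linear : forall i z, cm_image i z -> forall (a : R) (u u' v : 'rV[C]_d),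
    kf_form i z (of_real a *: u + u') v = a * kf_form i z u v + kf_form i z u' v;
  kf_alternating : forall i z, cm_image i z -> forall u v : 'rV[C]_d,
    kf_form i z v u = - kf_form i z u v;
  kf_J : forall i z, cm_image i z -> forall u v : 'rV[C]_d,
    kf_form i z ('i *: u) ('i *: v) = kf_form i z u v;
  kf_pos : forall i z, cm_image i z -> forall v : 'rV[C]_d, v != 0 ->
    0 < kf_form i z v ('i *: v);
  kf_smooth : forall i (u v : 'rV[C]_d),
    smooth_on (cm_image i) (fun z => kf_form i z u v);
  kf_compatible : forall i j z, cm_overlap i j z -> forall u v : 'rV[C]_d,
    kf_form i z u v =
    kf_form j (cm_transition i j z) ('d (cm_transition i j) z u)
                                    ('d (cm_transition i j) z v);
  kf_closed : forall i z, cm_image i z -> forall u v w : 'rV[C]_d,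
    real_deriv u (fun y => kf_form i y v w) z +
    real_deriv v (fun y => kf_form i y w u) z +
    real_deriv w (fun y => kf_form i y u v) z = 0
}.

Definition compact_connected (X : complex_manifold) : Prop :=
  compact [set: X] /\ connected [set: X].

Definition compact_kahler (X : complex_manifold) : Prop :=
  compact_connected X /\ inhabited (kahler_form X).

(* A holomorphic 1-form; in the chart i it maps the tangent vector u at z to
   the entry of the 1 x 1 matrix u *m a i z. *)
Definition holomorphic_form (X : complex_manifold)
    (a : cm_index X -> 'rV[C]_d -> 'cV[C]_d) : Prop :=
  (forall i, holomorphic_on (cm_image i) (a i)) /\
  (forall i j z, cm_overlap i j z -> forall u : 'rV[C]_d,
     u *m a i z = 'd (cm_transition i j) z u *m a j (cm_transition i j z)).

End ComplexManifold.

(* g = dim H^0(Y, Omega^1): the space of holomorphic 1-forms has a basis b with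
   g elements. *)
Definition has_genus (R : realType) (Y : complex_manifold R 1) (g : nat) : Prop :=
  exists b : 'I_g -> cm_index Y -> 'rV[Cplx R]_1 -> 'cV[Cplx R]_1,
    [/\ forall k, holomorphic_form (b k),
        forall c : 'I_g -> Cplx R,
          (forall i z, cm_image i z -> \sum_k c k *: b k i z = 0) ->
          forall k, c k = 0
      & forall a, holomorphic_form a ->
          exists c : 'I_g -> Cplx R,
            forall i z, cm_image i z -> a i z = \sum_k c k *: b k i z].

Definition is_curve (R : realType) (Y : complex_manifold R 1) : Prop :=
  compact_connected Y.

(* Main.v *)
Require Import Defs.
From HB Require Import structures.
From mathcomp Require Import all_boot all_order all_algebra.
From mathcomp Require Import all_classical all_reals all_analysis.
From mathcomp Require Import homotopy.
From mathcomp Require Import complex mxred spectral lra.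
Import Order.TTheory GRing.Theory Num.Theory.
Import numFieldTopology.Exports numFieldNormedType.Exports.

Set Implicit Arguments.
Unset Strict Implicit.
Unset Printing Implicit Defensive.

Local Open Scope classical_set_scope.
Local Open Scope ring_scope.

(** The first alternative always holds. If [f] is a representation of a group [G]
    by matrices with solvable image, some subgroup of finite index has a common
    eigenvector [v] (a form of the Lie-Kolchin-Mal'cev theorem), and a smaller
    subgroup of finite index acts diagonally on the [G]-orbit of [v]. Hence every
    nonzero invariant subspace contains a nonzero invariant subspace [W] on which
    a subgroup of finite index acts through commuting matrices. Start with [U = 0]
    and repeat: deform [f] to a representation that splits as [U] plus a
    complement by shrinking the off-diagonal block of [f] to [0], then enlarge
    [U] by such a [W] inside the complement. At the end [U] is the whole space and
    the image is virtually abelian.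

    The common eigenvector comes from the finiteness of weights. If no subgroup
    of finite index leaves a proper nonzero subspace invariant, then, going up
    the derived series, each term [A] acts by scalars: the elements central in
    [f A] do, because [G] permutes the finitely many weights of a commuting
    family; and commutators of [A] are scalar, so conjugation by [f A] acts on
    the matrices [f b], [b] in [A], through finitely many characters, which gives
    [f g] only finitely many conjugates, hence a centraliser of finite index,
    which preserves an eigenspace of [f g]. *)

(** * Subgroups of finite index *)

Section FiniteIndex.
Variable G : groupType.
Local Open Scope group_scope.
Implicit Types H K L : set G.

(* Right cosets are used because matrices act on row vectors from the right;
   [H] need not be contained in [K]. *)
Definition fin_index H K : Prop := exists (T : Type) (phi : G -> T),
  finite_set (phi @` K) /\
  forall x y, K x -> K y -> phi x = phi y -> H (x * y^-1).

Lemma image_section K T (phi : G -> T) :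
  exists r : T -> G, forall x, K x -> K (r (phi x)) /\ phi (r (phi x)) = phi x.
Proof.
have [r rP] := @choice T G (fun t x => (phi @` K) t -> K x /\ phi x = t)
  (fun t => match pselect ((phi @` K) t) with
     | left (ex_intro2 x Kx e) => ex_intro _ x (fun=> conj Kx e)
     | right nKt => ex_intro _ 1 (fun Kt => False_ind _ (nKt Kt)) end).
by exists r => x Kx; apply: rP; exists x.
Qed.

Lemma fin_index_reps H K : fin_index H K -> exists s : seq G,
  (forall y, y \in s -> K y) /\
  (forall x, K x -> exists2 y, y \in s & H (x * y^-1)).
Proof.
case=> T [phi [fphi phiP]]; have [r rP] := @image_section K T phi.
have /finite_seqP[s sE] : finite_set (r @` (phi @` K)) by exact: finite_image.
exists s; split=> [y ys|x Kx].
  have : [set` s] y by [].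
  by rewrite -sE => -[_ [x Kx <-] <-]; case: (rP x Kx).
have [Kr er] := rP x Kx; exists (r (phi x)); last exact: phiP.
suff : [set` s] (r (phi x)) by [].
by rewrite -sE; exists (phi x) => //; exists x.
Qed.

Lemma fin_indexS H H' K : H `<=` H' -> fin_index H K -> fin_index H' K.
Proof.
move=> HH' [T [phi [fphi phiP]]]; exists T, phi; split=> // x y Kx Ky exy.
exact/HH'/phiP.
Qed.

Lemma fin_index_refl H : is_subgroup H -> fin_index H H.
Proof.
move=> [_ HM HV]; exists unit, (fun=> tt); split=> [|x y Hx Hy _].
  exact: finite_finset.
by apply: HM => //; exact: HV.
Qed.

(** Label [x] by its [phi]-class and by the [psi]-class of its quotient by the chosen
    representative; if both labels agree, the representatives agree and cancel. *)
Lemma fin_index_trans H K L : fin_index H K -> fin_index L H -> fin_index L K.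
Proof.
case=> T [phi [fphi phiP]] [T' [psi [fpsi psiP]]].
have [r rP] := @image_section K T phi.
exists (T * T')%type, (fun x => (phi x, psi (x * (r (phi x))^-1))); split.
  apply: (@sub_finite_set _ _ ((phi @` K) `*` (psi @` H))); last exact: finite_setX.
  move=> _ [x Kx <-]; split=> /=; first by exists x.
  have [? ?] := rP x Kx.
  by exists (x * (r (phi x))^-1) => //; exact: phiP.
move=> x y Kx Ky [exy].
have [Krx erx] := rP x Kx; have [Kry ery] := rP y Ky.
move/psiP; rewrite exy invgM invgK mulgA mulgVK; apply.
  by apply: phiP => //; rewrite -exy erx.
by apply: phiP => //; rewrite ery.
Qed.

Lemma fin_index_setI H H' K :
  fin_index H K -> fin_index H' K -> fin_index (H `&` H') K.
Proof.
case=> T [phi [fphi phiP]] [T' [psi [fpsi psiP]]].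
exists (T * T')%type, (fun x => (phi x, psi x)); split.
  apply: (@sub_finite_set _ _ ((phi @` K) `*` (psi @` K))); last exact: finite_setX.
  by move=> _ [x Kx <-]; split; exists x.
by move=> x y Kx Ky [exy exy']; split; [exact: phiP|exact: psiP].
Qed.

Lemma fin_index_all (I : eqType) (Hs : I -> set G) K (s : seq I) :
  (forall i, i \in s -> fin_index (Hs i) K) ->
  fin_index [set x | forall i, i \in s -> Hs i x] K.
Proof.
elim: s => [_|i s IHs fs].
  exists unit, (fun=> tt); split=> //; exact: finite_finset.
rewrite (_ : [set _ | _] = Hs i `&` [set x | forall i, i \in s -> Hs i x]).
  apply: fin_index_setI; first by apply: fs; rewrite mem_head.
  by apply: IHs => j js; apply: fs; rewrite inE js orbT.
apply/seteqP; split=> x /=.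
  by move=> Hx; split=> [|j js]; apply: Hx; rewrite inE ?eqxx ?js ?orbT.
by move=> [Hi Hx] j; rewrite inE => /orP[/eqP->//|/Hx].
Qed.

Lemma fin_index_conj H K g : is_subgroup K -> K g ->
  fin_index H K -> fin_index [set x | H (g * x * g^-1)] K.
Proof.
move=> [_ KM KV] Kg [T [phi [fphi phiP]]].
exists T, (fun x => phi (g * x)); split.
  by apply: sub_finite_set fphi => _ [x Kx <-]; exists (g * x) => //; exact: KM.
move=> x y Kx Ky /phiP -/(_ (KM _ _ Kg Kx) (KM _ _ Kg Ky)).
by rewrite /= invgM !mulgA.
Qed.

End FiniteIndex.

(** * The derived series and its normality *)

Section DerivedSeries.
Variable G : groupType.
Local Open Scope group_scope.
Implicit Types H K : set G.

Definition derived k K : set G := iter k (fun H => commutator_subgroup H H) K.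

Lemma commutator_subgroup_group H K : is_subgroup (commutator_subgroup H K).
Proof.
split=> [A [[]] //|x y Dx Dy A AP|x Dx A AP].
  by have := AP; move=> [[_ AM _] _]; apply: AM; [exact: Dx|exact: Dy].
by have := AP; move=> [[_ _ AV] _]; apply: AV; exact: Dx.
Qed.

Lemma mem_commutator H K a b :
  H a -> K b -> commutator_subgroup H K (commg a b).
Proof. by move=> Ha Kb; apply: sub_gen_smallest; exists a => //; exists b. Qed.

Lemma commutatorS H H' K K' : H `<=` H' -> K `<=` K' ->
  commutator_subgroup H K `<=` commutator_subgroup H' K'.
Proof.
move=> HH KK; apply: smallest_sub; first exact: commutator_subgroup_group.
by move=> _ [a Ha [b Kb <-]]; apply: mem_commutator; [exact: HH|exact: KK].
Qed.

Lemma derivedS k H K : H `<=` K -> derived k H `<=` derived k K.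
Proof. by move=> HK; elim: k => //= k IH; exact: commutatorS. Qed.

Lemma derived_group k K : is_subgroup K -> is_subgroup (derived k K).
Proof. by case: k => //= k _; exact: commutator_subgroup_group. Qed.

Lemma derived_sub k K : is_subgroup K -> derived k K `<=` K.
Proof.
move=> KG; elim: k => //= k IH; apply: smallest_sub => // _ [a /IH Ka [b /IH Kb <-]].
case: KG => _ KM KV; rewrite /commg /conjg.
by apply: (KM); [exact: KV|apply: (KM); [exact: KV|exact: (KM)]].
Qed.

Lemma derived_conj k K x y : is_subgroup K -> K x -> derived k K y ->
  derived k K (x * y * x^-1).
Proof.
move=> KG Kx; elim: k y => [y Ky|k IH] /=.
  by case: KG => _ KM KV; apply: (KM); [exact: (KM)|exact: KV].
pose P y := commutator_subgroup (derived k K) (derived k K) (x * y * x^-1).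
suff: commutator_subgroup (derived k K) (derived k K) `<=` P by [].
have [D1 DM DV] := commutator_subgroup_group (derived k K) (derived k K).
apply: smallest_sub.
  split; rewrite /P.
  - by rewrite mulg1 mulgV.
  - move=> a b Pa Pb; rewrite (_ : _ * _ * _ = (x * a * x^-1) * (x * b * x^-1)).
      exact: DM.
    by rewrite !mulgA mulgVK.
  - move=> a /DV; by rewrite !invgM invgK !mulgA.
move=> _ [a Da [b Db <-]]; rewrite /P.
rewrite (_ : _ * _ * _ = commg (x * a * x^-1) (x * b * x^-1)).
  by apply: mem_commutator; exact: IH.
by rewrite /commg /conjg !invgM !invgK !mulgA !mulgVK.
Qed.

End DerivedSeries.

(** * Weights of a family of linear maps *)

Section Weights.
Variables (F : fieldType) (V : vectType F) (S : Type) (a : S -> {linear V -> V}).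

Definition is_weight (w : S -> F) : Prop :=
  exists2 v : V, v != 0 & forall s, a s v = w s *: v.

(** Applying [a s] to the relation and subtracting [w j s] times it removes [v j] and scales [v i]
    by [w i s - w j s]; for each [i] some [s] makes this factor nonzero. *)
Lemma weight_vectors_independent (I : eqType) (w : I -> S -> F) (v : I -> V)
    (r : seq I) :
  injective w -> uniq r -> (forall i s, a s (v i) = w i s *: v i) ->
  \sum_(i <- r) v i = 0 -> forall i, i \in r -> v i = 0.
Proof.
move=> wI; elim: r v => [//|j r IH] v /= /andP[jr ur] av.
rewrite big_cons => sum0.
have v0 i : i \in r -> v i = 0.
  move=> ir; have /eqP/funeqP wij : w i != w j.
    by apply: contraNN jr => /eqP/wI <-.
  have [s wsij] : exists s, w i s != w j s.
    apply: contrapT => nw; apply: wij => s.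
    by apply/eqP/negPn/negP => ?; apply: nw; exists s.
  have := IH (fun i => (w i s - w j s) *: v i) ur _ _ i ir.
  have avs k t : a t ((w k s - w j s) *: v k) = w k t *: ((w k s - w j s) *: v k).
    by rewrite linearZ /= av !scalerA mulrC.
  move=> /(_ avs) H; apply/eqP; move: H; rewrite (_ : \sum_(k <- r) _ = 0).
    by move=> /(_ erefl)/eqP; rewrite scaler_eq0 subr_eq0 (negbTE wsij).
  under eq_bigr => k _ do rewrite scalerBl -av.
  rewrite sumrB -linear_sum -scaler_sumr -[X in _ - X](addKr (w j s *: v j)).
  rewrite -scalerDr sum0 scaler0 addr0 opprK addrC -av -linearD.
  by rewrite sum0 linear0.
move=> i; rewrite inE => /orP[/eqP->|/v0//].
by move: sum0; rewrite big_seq big1 ?addr0 // => k /v0.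
Qed.

(** Infinitely many weights would give more independent vectors than the dimension of [V] allows. *)
Lemma finite_weights : finite_set [set w | is_weight w].
Proof.
apply: contrapT => /infiniteP/card_leP[h].
pose w (i : nat) : S -> F := set_val (h (exist _ i (mem_set I))).
have wW i : is_weight (w i) by apply: (set_valP (h _)).
have wI : injective w.
  move=> i j /val_inj hij.
  by have [] := injT hij.
have [v vP] := @choice nat V (fun i u => u != 0 /\ forall s, a s u = w i s *: u)
  (fun i => let: ex_intro2 u u0 au := wW i in ex_intro _ u (conj u0 au)).
pose N := (\dim {: V}).+1.
pose X := [tuple v i | i < N].
have : free X.
  apply/freeP => k sum0 i.
  have XE (j : 'I_N) : X`_j = v j.
    by rewrite (nth_map j) ?size_enum_ord ?nth_ord_enum.
  have wI' : injective (w \o @nat_of_ord N) by move=> ? ? /wI/val_inj.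
  have kv j s : a s (k j *: v j) = (w \o @nat_of_ord N) j s *: (k j *: v j).
    by rewrite linearZ /= (proj2 (vP j)) !scalerA mulrC.
  have : k i *: v i = 0.
    apply: (weight_vectors_independent wI' (enum_uniq 'I_N) kv); last first.
      exact: mem_enum.
    by rewrite big_enum /= -[RHS]sum0; apply: eq_bigr => j _; rewrite XE.
  by move/eqP; rewrite scaler_eq0 (negbTE (proj1 (vP i))) orbF => /eqP.
rewrite /free size_tuple => /eqP dimX.
by have := dimvS (subvf <<X>>%VS); rewrite dimX ltnn.
Qed.
End Weights.

(** * Subspaces described by a predicate *)

Section RowSpaces.
Variables (F : fieldType) (n : nat).

(** Starting from 0, vectors of [P] outside [W] are added to [W]; each raises the rank, so this ends
    after at most [n] additions. *)
Lemma row_space_of_pred (P : 'rV[F]_n -> Prop) :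
  P 0 -> (forall c u v, P u -> P v -> P (c *: u + v)) ->
  exists W : 'M[F]_n, forall v, (v <= W)%MS <-> P v.
Proof.
move=> P0 Plin.
suff: forall m (W : 'M[F]_n), (n - \rank W <= m)%N ->
    (forall v : 'rV_n, (v <= W)%MS -> P v) ->
    exists W : 'M[F]_n, forall v, (v <= W)%MS <-> P v.
  by move=> /(_ _ 0 (leqnn _)); apply=> v; rewrite submx0 => /eqP ->.
elim=> [|m IH] W rW WP.
  exists W => v; split=> [/WP//|_].
  apply: submx_full; rewrite /row_full eqn_leq rank_leq_row /=.
  by rewrite -subn_eq0 -leqn0.
have [?|] := pselect (forall v, P v -> (v <= W)%MS).
  by exists W => v; split=> [/WP|]; auto.
move=> /existsNP[v /not_implyP[Pv vW]].
apply: (IH (W + v)%MS) => [|u /sub_addsmxP[[D E] /= ->]].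
  rewrite -ltnS; apply: leq_trans rW; apply: ltn_sub2l.
    rewrite ltn_neqAle rank_leq_row andbT; apply: contra_notN vW => /eqP rW.
    by apply: submx_full; rewrite /row_full rW.
  apply: rank_ltmx; rewrite /ltmx addsmxSl /=.
  by apply: contra_notN vW => /(submx_trans (addsmxSr _ _)).
rewrite addrC [E]mx11_scalar mul_scalar_mx; apply: Plin => //.
by apply: WP; exact: submxMl.
Qed.

End RowSpaces.

(** * Eigenvectors of commuting matrices; roots of unity *)

Section CommonEigenvector.
Variables (F : numClosedFieldType) (n : nat).

Lemma eigenvector_in_stable (W A : 'M[F]_n) : W != 0 -> stablemx W A ->
  exists c, (W :&: eigenspace A c)%MS != 0.
Proof.
move=> W0 sWA; have rW : (0 < \rank W)%N by rewrite lt0n mxrank_eq0.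
have [c /eigenvalueP[v /eigenspaceP vc v0]] := eigenvalue_closed (restrictmx W A) rW.
exists c; apply/rowV0Pn; exists (v *m row_base W); last first.
  by rewrite mulmx_free_eq0 ?row_base_free.
rewrite sub_capmx (submx_trans (submxMl _ _)) ?eq_row_base //=.
by rewrite -sub_eigenspace_conjmx ?row_base_free ?stablemx_row_base.
Qed.

(** If some [a s] is not scalar on [U], one of its eigenspaces cuts out a smaller nonzero subspace,
    stable under the whole family by commutation. Since [S] may be infinite, the induction is on
    [\rank U]. *)
Lemma common_eigenvector_family (S : Type) (a : S -> 'M[F]_n) : (0 < n)%N ->
  (forall s t, a s *m a t = a t *m a s) ->
  exists2 v : 'rV[F]_n, v != 0 & forall s, exists c, v *m a s = c *: v.
Proof.
move=> n0 aC.
suff: forall m (U : 'M[F]_n), (\rank U <= m)%N -> U != 0 ->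
    (forall s, stablemx U (a s)) ->
    exists2 v : 'rV[F]_n, v != 0 & forall s, exists c, v *m a s = c *: v.
  move=> /(_ _ 1%:M (leqnn _)); apply=> [|s]; last exact: stableCmx.
  by rewrite -mxrank_eq0 mxrank1 -lt0n.
elim=> [U|m IH U rU U0 sU].
  by rewrite leqn0 mxrank_eq0 => ->.
have [H|] := pselect (forall s, exists c, U *m a s = c *: U).
  have /rowV0Pn[v /submxP[D ->] v0] := U0.
  exists (D *m U) => // s; have [c E] := H s; exists c.
  by rewrite -mulmxA E scalemxAr.
move=> /existsNP[s /forallNP ns].
have [c Uc0] := eigenvector_in_stable U0 (sU s).
apply: (IH _ _ Uc0) => [|t].
  rewrite -ltnS; apply: leq_trans rU; apply: rank_ltmx.
  rewrite /ltmx capmxSl /=; apply/negP => sub.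
  apply: (ns c); apply/eigenspaceP; apply: submx_trans sub _; exact: capmxSr.
rewrite sub_capmx (submx_trans (submxMr _ (capmxSl _ _))) //=.
rewrite (submx_trans (submxMr _ (capmxSr _ _))) //.
by apply: comm_mx_stable_eigenspace; exact: aC.
Qed.

Lemma finite_roots_of_unity (m : nat) :
  (0 < m)%N -> finite_set [set c : F | c ^+ m = 1].
Proof.
move=> m0; have [r rE] := closed_field_poly_normal ('X^m - 1 : {poly F}).
apply: (@sub_finite_set _ _ [set` r]); last exact: finite_seq.
move=> c /= cm; have : root ('X^m - 1) c by rewrite /root !hornerE cm subrr.
by rewrite rE (monicP _) ?scale1r ?root_prod_XsubC // -polyC1 monicXnsubC.
Qed.

End CommonEigenvector.

(** * Matrix representations with solvable image *)

Section HomOn.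
Variables (F : numClosedFieldType) (G : groupType).
Implicit Types H K A Z : set G.

(** Products are considered on [K] only, because restricting [f] to a subspace need not respect
    products outside the subgroup that preserves it. *)
Definition hom_on K n (f : G -> 'M[F]_n) : Prop :=
  f 1%g = 1%:M /\ forall x y, K x -> K y -> f (x * y)%g = f x *m f y.

Section One.
Variables (K : set G) (n : nat) (f : G -> 'M[F]_n).
Hypotheses (KG : is_subgroup K) (fK : hom_on K f).

Lemma hom_mulV x : K x -> f x *m f x^-1%g = 1%:M.
Proof.
by case: KG fK => _ _ KV [f1 fM] Kx; rewrite -fM ?mulgV //; exact: KV.
Qed.

Lemma hom_Vmul x : K x -> f x^-1%g *m f x = 1%:M.
Proof.
by case: KG fK => _ _ KV [f1 fM] Kx; rewrite -fM ?mulVg //; exact: KV.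
Qed.

Lemma hom_conj x y : K x -> K y ->
  f (x * y * x^-1)%g = f x *m f y *m f x^-1%g.
Proof.
by case: KG fK => _ KM KV [f1 fM] Kx Ky; rewrite !fM //; [exact: KM|exact: KV].
Qed.

Lemma hom_conjM x y : K x -> K y -> f (x * y * x^-1)%g *m f x = f x *m f y.
Proof. by move=> Kx Ky; rewrite hom_conj // -mulmxA hom_Vmul // mulmx1. Qed.

Lemma hom_mulmx_eq0 m (u : 'M[F]_(m, n)) x : K x -> (u *m f x == 0) = (u == 0).
Proof.
move=> Kx; apply/eqP/eqP => [u0|->]; last by rewrite mul0mx.
by rewrite -[u]mulmx1 -(hom_mulV Kx) mulmxA u0 mul0mx.
Qed.

Lemma hom_neq0 x : (0 < n)%N -> K x -> f x != 0.
Proof.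
move=> n0 Kx; rewrite -[f x]mul1mx hom_mulmx_eq0 // -mxrank_eq0 mxrank1.
by rewrite -lt0n.
Qed.

(* The hypothesis says that no subgroup of finite index of [K] leaves a proper
   nonzero subspace invariant. *)
Section StronglyIrreducible.
Hypothesis n0 : (0 < n)%N.
Hypothesis irr : forall H, is_subgroup H -> H `<=` K -> fin_index H K ->
  forall W : 'M[F]_n, W != 0 -> (forall x, H x -> stablemx W (f x)) -> row_full W.

(** [K] moves the weight [w] through a finite set, so its stabiliser [H] has finite index; [H]
    preserves the weight space [W] of [w], which is therefore everything. *)
Lemma irr_commuting_scalar Z : Z `<=` K ->
  (forall x z, K x -> Z z -> Z (x * z * x^-1)%g) ->
  (forall y z, Z y -> Z z -> f y *m f z = f z *m f y) ->
  forall z, Z z -> is_scalar_mx (f z).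
Proof.
move=> ZK Znorm Zcomm.
have [_ KM KV] := KG; have [f1 fM] := fK.
pose S := {z | Z z};
pose a (s : S) : {linear 'rV[F]_n -> 'rV[F]_n} :=
  [the {linear _ -> _} of mulmxr (f (sval s))].
have [v v0 vP] : exists2 v : 'rV[F]_n, v != 0 &
    forall s : S, exists c, v *m f (sval s) = c *: v.
  by apply: common_eigenvector_family => // s t; apply: Zcomm; exact: svalP.
have /choice[w wP] : forall z, exists c, Z z -> v *m f z = c *: v.
  move=> z; have [Zz|nZ] := pselect (Z z); last by exists 0.
  by have [c E] := vP (exist _ z Zz); exists c.
(* The weight of [v *m f x]. *)
pose phi x : S -> F := fun s => w (x * sval s * x^-1)%g.
have phiP x : K x -> is_weight a (phi x).
  move=> Kx; exists (v *m f x); first by rewrite hom_mulmx_eq0.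
  move=> [z Zz]; rewrite /a /phi /=.
  rewrite -mulmxA -hom_conjM ?mulmxA //; last exact: ZK.
  by rewrite wP -?scalemxAl //; exact: Znorm.
pose H := [set x | K x /\ forall z, Z z -> w (x * z * x^-1)%g = w z].
have HG : is_subgroup H.
  split=> [|x y [Kx Hx] [Ky Hy]|x [Kx Hx]].
  - by split=> [|z]; [case: KG | rewrite mul1g invg1 mulg1].
  - split=> [|z Zz]; first exact: KM.
    rewrite (_ : _ * _ * _ = x * (y * z * y^-1) * x^-1)%g ?Hx ?Hy //.
      exact: Znorm.
    by rewrite invgM !mulgA.
  - have Kx' := KV _ Kx; split=> // z Zz.
    rewrite -(Hx (x^-1 * z * (x^-1)^-1)%g); last exact: Znorm.
    by rewrite invgK !mulgA mulgV mul1g mulgK.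
have HK : H `<=` K by move=> x [].
have HF : fin_index H K.
  exists (S -> F), phi; split.
    by apply: sub_finite_set (finite_weights _) => _ [x Kx <-]; exact: phiP Kx.
  move=> x y Kx Ky exy; have Ky' := KV _ Ky; split=> [|z Zz]; first exact: KM.
  have Zz' : Z (y^-1 * z * (y^-1)^-1)%g by exact: Znorm.
  have := congr1 (fun h => h (exist _ _ Zz')) exy; rewrite /phi /= !invgK !mulgA.
  by rewrite mulgV mul1g mulgK invgM invgK !mulgA.
have [W WP] := @row_space_of_pred F n
  (fun u => forall z, Z z -> u *m f z = w z *: u)
  ltac:(by move=> z _; rewrite mul0mx scaler0)
  ltac:(by move=> c u u' uP uP' z Zz; rewrite mulmxDl -scalemxAl uP // uP' //
        scalerDr !scalerA mulrC).
have W0 : W != 0 by apply/rowV0Pn; exists v => //; apply/WP.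
have sW x : H x -> stablemx W (f x).
  move=> [Kx Hx]; apply/row_subP => i; rewrite row_mul.
  have /WP rP : (row i W <= W)%MS by exact: row_sub.
  apply/WP => z Zz; rewrite -mulmxA -hom_conjM ?mulmxA //; last exact: ZK.
  by rewrite rP ?Hx -?scalemxAl //; exact: Znorm.
have Wfull := irr HG HK HF W0 sW.
move=> z Zz; apply/is_scalar_mxP; exists (w z); apply/row_matrixP => i.
rewrite [LHS]rowE -/(delta_mx 0 i *m f z) (_ : _ *m f z = w z *: delta_mx 0 i).
  by rewrite -mul_mx_scalar -rowE.
by apply: (proj1 (WP _)) => //; exact: submx_full.
Qed.

(** As commutators are scalar, [f a] conjugates [f b] to its multiple by [chi b a]. Elements with
    the same character differ by a central, hence scalar, factor; between conjugates of [g],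
    comparing determinants makes it a root of unity. *)
Lemma irr_class2_scalar A : A `<=` K -> is_subgroup A ->
  (forall x a, K x -> A a -> A (x * a * x^-1)%g) ->
  (forall a b, A a -> A b -> is_scalar_mx (f (commg a b))) ->
  forall g, A g -> is_scalar_mx (f g).
Proof.
move=> AsubK [A1 AM AV] Anorm Acomm; have AK a : A a -> K a by exact: AsubK.
have [_ KM KV] := KG; have [f1 fM] := fK.
(* The elements of [A] whose image is central in [f A]. *)
pose Z := [set z | A z /\ forall a, A a -> f z *m f a = f a *m f z].
have Zscal z : Z z -> is_scalar_mx (f z).
  apply: irr_commuting_scalar => [y [/AK]//|x y Kx [Ay Cy]|x y [Ax Cx] [Ay _]];
    last exact: Cx.
  split=> [|a Aa]; first exact: Anorm.
  have Kx' := KV _ Kx.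
  have := Cy _ (Anorm _ _ Kx' Aa); have := hom_conj Kx' (AK _ Aa).
  have Ky := AK _ Ay; rewrite invgK hom_conj // => -> E.
  rewrite -[LHS]mulmx1 -(hom_mulV Kx).
  transitivity (f x *m (f y *m (f x^-1%g *m f a *m f x)) *m f x^-1%g).
    by rewrite !mulmxA.
  by rewrite E !mulmxA hom_mulV // mul1mx.
have [chi chiP] : exists chi : G -> G -> F, forall b a, A b -> A a ->
    f a *m f b *m f a^-1%g = chi b a *: f b.
  suff /choice[chi chiP] : forall b, exists h : G -> F, forall a, A b -> A a ->
      f a *m f b *m f a^-1%g = h a *: f b by exists chi.
  move=> b; suff /choice[h hP] : forall a, exists c, A b -> A a ->
      f a *m f b *m f a^-1%g = c *: f b by exists h.
  move=> a; have [Ab|?] := pselect (A b); last by exists 0.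
  have [Aa|?] := pselect (A a); last by exists 0.
  have [c E] := is_scalar_mxP (Acomm _ _ (AV _ Aa) (AV _ Ab)).
  have [Ka Kb] := conj (AK _ Aa) (AK _ Ab); have [KaV KbV] := conj (KV _ Ka) (KV _ Kb).
  exists c => _ _; rewrite -fM // commgCV fM; last first.
  - exact: KM.
  - by rewrite /commg /conjg; do ![apply: (KM) => // | apply: (KV) => //].
  rewrite E mul_scalar_mx -scalemxAl fM // -mulmxA hom_mulV ?mulmx1 //.
move=> g Ag; have Kg := AK _ Ag.
pose S := {a | A a}.
pose psi b : S -> F := fun s => chi b (sval s).
pose cj (s : S) : {linear 'M[F]_n -> 'M[F]_n} :=
  [the {linear _ -> _} of mulmxr (f (sval s)^-1%g) \o mulmx (f (sval s))].
have psiP b : A b -> is_weight cj (psi b).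
  move=> Ab; exists (f b); first by apply: hom_neq0 => //; exact: AK.
  by move=> [a Aa]; rewrite /cj /psi /= chiP.
have psiE b b' : A b -> A b' -> psi b = psi b' -> exists c, f b = c *: f b'.
  move=> Ab Ab' e; have Zz : Z (b * (b')^-1)%g.
    split=> [|a Aa]; first by apply: (AM) => //; exact: AV.
    have [Ka Kb Kb'] := And3 (AK _ Aa) (AK _ Ab) (AK _ Ab').
    have Kb'V := KV _ Kb'; set c := chi b a.
    have C1 : f a *m f b = c *: (f b *m f a).
      by rewrite scalemxAl -chiP // -mulmxA hom_Vmul // mulmx1.
    have C2 : f a *m f b' = c *: (f b' *m f a).
      have -> : c = chi b' a by exact: (congr1 (fun h => h (exist _ a Aa)) e).
      by rewrite scalemxAl -chiP // -mulmxA hom_Vmul // mulmx1.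
    (* The same [c] appears for [b] and, with the sides exchanged, for the inverse of [b']; so it
       cancels for their product. *)
    have C3 : f (b')^-1%g *m f a = c *: (f a *m f (b')^-1%g).
      rewrite -[LHS]mulmx1 -(hom_mulV Kb') mulmxA -(mulmxA _ (f a)) C2.
      by rewrite -scalemxAr -scalemxAl !mulmxA hom_Vmul // mul1mx.
    by rewrite fM // -mulmxA C3 mulmxA C1 -scalemxAr -scalemxAl mulmxA.
  have [c E] := is_scalar_mxP (Zscal _ Zz); exists c.
  have [Kb Kb'] := conj (AK _ Ab) (AK _ Ab').
  by rewrite -mul_scalar_mx -E -fM ?mulgVK //; apply: (KM) => //; exact: KV.
pose cl := [set (x^-1 * g * x)%g | x in K].
have clA b : cl b -> A b.
  by move=> [x /KV Kx <-]; have := Anorm _ _ Kx Ag; rewrite invgK.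
have fin : finite_set [set f b | b in cl].
  have [r rP] := @image_section _ cl _ psi.
  (* Each conjugate is an [n]-th root of unity times the matrix chosen for its character, and both
     range over finite sets. *)
  apply: (@sub_finite_set _ _ [set c *: M | c in [set c : F | c ^+ n = 1]
                                 & M in (fun w => f (r w)) @` (psi @` A)]).
    move=> _ [b clb <-]; have [clr er] := rP _ clb.
    have [c E] := psiE _ _ (clA _ clb) (clA _ clr) (esym er).
    exists c; last first.
      by exists (f (r (psi b))); [exists (psi b) => //; exists b => //; exact: clA|].
    have detf b' : cl b' -> \det (f b') = \det (f g).
      move=> [x Kx <-]; have := hom_conj (KV _ Kx) Kg; rewrite invgK => ->.
      by rewrite !det_mulmx mulrAC -det_mulmx hom_Vmul // det1 mul1r.
    have detg : \det (f g) != 0.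
      by rewrite -unitfE -unitmxE; have /mulmx1_unit[] := hom_mulV Kg.
    have := congr1 determinant E; rewrite detZ !detf // => /esym/eqP.
    by rewrite -subr_eq0 -[X in _ - X]mul1r -mulrBl mulf_eq0 subr_eq0 (negbTE detg)
      orbF => /eqP.
  apply: finite_image2; first exact: finite_roots_of_unity.
  apply: finite_image; apply: sub_finite_set (finite_weights cj).
  by move=> _ [b Ab <-]; exact: psiP.
pose H := [set x | K x /\ f x *m f g = f g *m f x].
have HG : is_subgroup H.
  split=> [|x y [Kx Hx] [Ky Hy]|x [Kx Hx]].
  - by split; [case: KG | rewrite f1 mulmx1 mul1mx].
  - by split; [exact: KM | rewrite fM // -mulmxA Hy !mulmxA Hx].
  - split; first exact: KV.
    rewrite -[LHS]mulmx1 -(hom_mulV Kx) mulmxA -(mulmxA _ (f g)) -Hx.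
    by rewrite !mulmxA hom_Vmul // mul1mx.
have HF : fin_index H K.
  exists 'M[F]_n, (fun x => f (x^-1 * g * x)%g); split=> [|x y Kx Ky].
    by apply: sub_finite_set fin => _ [x Kx <-]; exists (x^-1 * g * x)%g => //; exists x.
  have := hom_conj (KV _ Kx) Kg; have := hom_conj (KV _ Ky) Kg.
  rewrite !invgK => -> -> E; have Ky' := KV _ Ky.
  split; first exact: KM.
  rewrite fM // -[LHS]mulmx1 -(hom_mulV Ky).
  transitivity (f x *m (f y^-1%g *m f g *m f y) *m f y^-1%g).
    by rewrite !mulmxA.
  by rewrite -E !mulmxA hom_mulV // mul1mx.
(* [H] preserves the eigenspaces of [f g], so a nonzero one is the whole space. *)
have [c /eigenvalueP[v vc v0]] := eigenvalue_closed (f g) n0.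
have W0 : eigenspace (f g) c != 0.
  by apply/rowV0Pn; exists v => //; apply/eigenspaceP.
have /irr : forall x, H x -> stablemx (eigenspace (f g) c) (f x).
  by move=> x [_ Hx]; apply: comm_mx_stable_eigenspace.
move=> /(_ HG (fun x => @proj1 _ _) HF W0); rewrite -sub1mx => /eigenspaceP.
by rewrite mul1mx scalemx1 => ->; exact: scalar_mx_is_scalar.
Qed.

Lemma irr_solvable_scalar k : (forall x, derived k K x -> f x = 1%:M) ->
  forall x, K x -> is_scalar_mx (f x).
Proof.
move=> triv.
(* Scalar, unlike trivial, is a property that passes from each term of the derived series to the
   preceding one. *)
have {triv} : forall x, derived k K x -> is_scalar_mx (f x).
  by move=> x /triv ->; exact: scalar_mx_is_scalar.
elim: k => [//|k IH] scal; apply: IH; apply: irr_class2_scalar.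
- exact: derived_sub.
- exact: derived_group.
- by move=> x a Kx; exact: derived_conj.
- by move=> a b Da Db; apply: scal; exact: mem_commutator.
Qed.

End StronglyIrreducible.
End One.

(** Induction on [n]: in the strongly irreducible case all of [K] is scalar and any nonzero vector
    serves; otherwise the vector is found in a proper subspace [W] and carried back by
    [row_base W]. *)
Lemma solvable_common_eigenvector n K (f : G -> 'M[F]_n) k :
  (0 < n)%N -> is_subgroup K -> hom_on K f ->
  (forall x, derived k K x -> f x = 1%:M) ->
  exists H, [/\ is_subgroup H, H `<=` K, fin_index H K &
    exists2 v : 'rV[F]_n, v != 0 & forall x, H x -> stablemx v (f x)].
Proof.
elim/ltn_ind: n K f => n IH K f n0 KG fK triv.
have [irr|] := pselect (forall H, is_subgroup H -> H `<=` K -> fin_index H K ->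
  forall W : 'M[F]_n, W != 0 -> (forall x, H x -> stablemx W (f x)) -> row_full W).
  exists K; split=> //; first exact: fin_index_refl.
  have /rowV0Pn[v _ v0] : (1%:M : 'M[F]_n) != 0.
    by rewrite -mxrank_eq0 mxrank1 -lt0n.
  exists v => // x Kx.
  have /is_scalar_mxP[c ->] := irr_solvable_scalar KG fK n0 irr triv Kx.
  exact: stablemxC.
move=> /existsNP[H /not_implyP[HG /not_implyP[HK /not_implyP[HF /existsNP[W]]]]].
move=> /not_implyP[W0 /not_implyP[sW /negP nW]].
have rW : (\rank W < n)%N by rewrite ltn_neqAle nW rank_leq_row.
have rW0 : (0 < \rank W)%N by rewrite lt0n mxrank_eq0.
pose f' x := restrictmx W (f x).
have f'H : hom_on H f'.
  have [f1 fM] := fK; split; first by rewrite /f' f1 conjmx_scalar ?row_base_free.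
  move=> x y Hx Hy; rewrite /f' fM; [|exact: HK|exact: HK].
  by rewrite conjmxM ?inE ?stablemx_row_base; [| exact: sW | exact: sW].
have triv' x : derived k H x -> f' x = 1%:M.
  by move=> /(derivedS HK)/triv; rewrite /f' => ->; rewrite conjmx_scalar ?row_base_free.
have [H' [H'G H'H H'F [v v0 sv]]] := IH _ rW _ _ rW0 HG f'H triv'.
exists H'; split=> //; first exact: subset_trans HK.
  exact: fin_index_trans H'F.
exists (v *m row_base W); first by rewrite mulmx_free_eq0 ?row_base_free.
by move=> x H'x; rewrite -stablemx_restrict; [exact: sv | apply: sW; exact: H'H].
Qed.

(* [W'] is spanned by the orbit of a vector of [W] that is a common eigenvector
   of a subgroup of finite index. *)
Lemma solvable_commuting_subspace n (f : G -> 'M[F]_n) k (W : 'M[F]_n) :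
  hom_on setT f -> (forall x, derived k setT x -> f x = 1%:M) ->
  W != 0 -> (forall x, stablemx W (f x)) ->
  exists (W' : 'M[F]_n) (N : set G), [/\ W' != 0, (W' <= W)%MS,
    forall x, stablemx W' (f x), is_subgroup N /\ fin_index N setT &
    forall x y, N x -> N y -> W' *m (f x *m f y - f y *m f x) = 0].
Proof.
move=> fT triv W0 sW; have [f1 fM] := fT.
have TG : is_subgroup (setT : set G) by [].
have rW0 : (0 < \rank W)%N by rewrite lt0n mxrank_eq0.
have fT' : hom_on setT (fun x => restrictmx W (f x)).
  split=> [|x y _ _]; first by rewrite f1 conjmx_scalar ?row_base_free.
  by rewrite fM // conjmxM ?inE ?stablemx_row_base.
have triv' x : derived k setT x -> restrictmx W (f x) = 1%:M.
  by move=> /triv ->; rewrite conjmx_scalar ?row_base_free.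
have [H [HG _ HF [v' v'0 sv']]] := solvable_common_eigenvector rW0 TG fT' triv'.
have [v [v0 vW sv]] : exists v : 'rV[F]_n,
    [/\ v != 0, (v <= W)%MS & forall x, H x -> stablemx v (f x)].
  exists (v' *m row_base W); split.
  - by rewrite mulmx_free_eq0 ?row_base_free.
  - by rewrite (submx_trans (submxMl _ _)) ?eq_row_base.
  - by move=> x Hx; rewrite -stablemx_restrict //; exact: sv'.
(* The span of the orbit of [v], as the intersection of all row spaces [M] containing it. *)
have [W' W'P] := @row_space_of_pred F n
  (fun u => forall M : 'M[F]_n, (forall x, v *m f x <= M)%MS -> (u <= M)%MS)
  ltac:(by move=> M _; rewrite sub0mx)
  ltac:(by move=> c u u' uP uP' M MP; rewrite addmx_sub ?scalemx_sub ?uP ?uP').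
have vW' x : (v *m f x <= W')%MS by apply/W'P.
have W'min (M : 'M[F]_n) : (forall x, v *m f x <= M)%MS -> (W' <= M)%MS.
  by move=> MP; apply/rV_subP => u /W'P; exact.
pose N := [set x | forall g, stablemx (v *m f g) (f x)].
exists W', N; split.
- apply/rowV0Pn; exists v => //.
  by have := vW' 1%g; rewrite f1 mulmx1.
- by apply: W'min => x; apply: submx_trans (sW x); exact: submxMr.
(* The translate of [W'] by the inverse of [y] contains the orbit as well, hence contains [W']. *)
- move=> y; have : (W' <= W' *m f y^-1%g)%MS.
    apply: W'min => x; rewrite (_ : v *m f x = v *m f (x * y)%g *m f y^-1%g).
      exact: submxMr.
    by rewrite -mulmxA -fM // mulgK.
  by move=> /(submxMr (f y)); rewrite -mulmxA -fM // mulVg f1 mulmx1.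
- split.
    split=> [g|x y Nx Ny g|x Nx g].
    + by rewrite f1 mulmx1.
    + by rewrite fM // stablemxM ?Nx ?Ny.
    + have /sub_rVP[c E] := Nx g; apply/sub_rVP; exists c^-1.
      have c0 : c != 0.
        have := v0; rewrite -(hom_mulmx_eq0 TG fT _ (I : setT g)).
        rewrite -(hom_mulmx_eq0 TG fT _ (I : setT x)) E.
        by apply: contraNneq => ->; rewrite scale0r.
      apply: (scalerI c0); rewrite scalerA mulfV // scale1r scalemxAl -E.
      by rewrite -[LHS]mulmxA (hom_mulV TG fT) // mulmx1.
  have [s [_ sP]] := fin_index_reps HF.
  (* The line of [v *m f g] depends only on the right coset of [g] modulo [H], so [N] contains a
     finite intersection of conjugates of [H]. *)
  apply: (fin_indexS _ (fin_index_all (s := s) (fun y _ => fin_index_conj TG I HF))).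
  move=> x /= Hx g; have [y ys Hgy] := sP g I.
  have /sub_rVP[c E] := sv _ Hgy.
  have gE : v *m f g = c *: (v *m f y).
    by rewrite scalemxAl -E -mulmxA -fM // mulgVK.
  have /sub_rVP[d E'] : stablemx (v *m f y) (f x).
    rewrite (_ : v *m f y *m f x = v *m f (y * x * y^-1)%g *m f y).
      by apply: submxMr; exact/sv/Hx.
    by rewrite -!mulmxA -!fM // mulgVK.
  apply/sub_rVP; exists d.
  by rewrite gE -scalemxAl E' !scalerA mulrC.
move=> x y Nx Ny; apply/sub_kermxP; apply: W'min => g; apply/sub_kermxP.
have /sub_rVP[c E] := Nx g; have /sub_rVP[c' E'] := Ny g.
rewrite mulmxBr !mulmxA E E' -!scalemxAl E E' !scalerA mulrC subrr //.
Qed.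

End HomOn.

(** * Continuity of affine paths of matrices *)

Section AffinePath.
Variable R : realType.
Local Notation I := (unit_interval R).

Lemma of_real_continuous : continuous (@of_real R).
Proof.
(* The radius is a complex number [a + b i]; its positivity means [b = 0] and [0 < a]. *)
move=> t; apply/cvgrPdist_lt => -[a b]; rewrite ltcE /= => /andP[/eqP b0 a0].
near=> u.
rewrite /of_real -rmorphB /= normc_def /= expr0n addr0 sqrtr_sqr ltcE /= b0 eqxx /=.
by near: u; apply: cvgr_dist_lt.
Unshelve. all: by end_near. Qed.

Lemma affine_path_continuous n (A B : 'M[Cplx R]_n) :
  continuous (fun t : I => A + of_real (ui_val t) *: B).
Proof.
move=> t; have h : (fun u : I => of_real (ui_val u)) @ t --> of_real (ui_val t).
  apply: (@continuous_comp _ _ _ (@ui_val R) (@of_real R)).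
    exact: ui_val_continuous.
  exact: of_real_continuous.
have hB := @cvgZr_tmp _ _ _ _ _ _ _ B h.
exact: (cvgD (@cst_continuous I 'M[Cplx R]_n A t) (hB (nbhs_filter t))).
Qed.
End AffinePath.

(** * From multiplicative matrix maps to representations *)

Section RepresentationOf.
Variables (F : fieldType) (G : groupType) (n : nat) (f : G -> 'M[F]_n).
Hypotheses (f1 : f 1%g = 1%:M) (fM : forall x y, f (x * y)%g = f x *m f y).

Lemma morphism_unitmx x : f x \in unitmx.
Proof. by have /mulmx1_unit[] : f x *m f x^-1%g = 1%:M by rewrite -fM mulgV. Qed.

Definition GL_of (x : G) : GL F n := MkGL (morphism_unitmx x).

Lemma GL_ofM x y : GL_of (x * y)%g = (GL_of x * GL_of y)%g.
Proof. by apply: val_inj; rewrite /= fM. Qed.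

HB.instance Definition _ := isMultiplicative.Build G (GL F n) GL_of GL_ofM.

End RepresentationOf.

(** * Deformation to a representation that commutes on a subgroup of finite index *)

Section Deformation.
Variables (R : realType) (G : groupType) (n : nat).
Local Notation C := (Cplx R).
Local Notation I := (unit_interval R).
Implicit Types rho sigma tau : representation R G n.

Lemma rep1 rho : rho 1%g = 1%:M :> 'M[C]_n.
Proof.
suff -> : rho 1%g = 1%g by [].
by apply: (mulgI (rho 1%g)); rewrite -gmulfM !mulg1.
Qed.

Lemma repM rho x y : rho (x * y)%g = rho x *m rho y :> 'M[C]_n.
Proof. by rewrite gmulfM. Qed.

Lemma deformable_refl rho : deformable_to rho rho.
Proof. by exists (fun=> rho); split=> // g; exact: cst_continuous. Qed.

Lemma deformable_trans rho sigma tau :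
  deformable_to rho sigma -> deformable_to sigma tau -> deformable_to rho tau.
Proof.
move=> [F [F0 F1 cF]] [F' [F'0 F'1 cF']].
exists (fun t => if ui_val t <= 2^-1 then F (ui_clamp (2 * ui_val t + 0))
                 else F' (ui_clamp (2 * ui_val t + -1))); split.
- move=> g; rewrite ui_val0 invr_ge0 ler0n mulr0 addr0.
  by rewrite -[ui_clamp 0]/(zero : I) F0.
- move=> g; rewrite ui_val1 ifF; last by apply/negbTE; rewrite -ltNge; lra.
  rewrite mulr1 (_ : 2 - 1 = 1 :> R); last by lra.
  by rewrite -[ui_clamp 1]/(one : I) F'1.
- move=> g.
  (* Evaluation at [g] is moved into the two branches, where [continuous_paste] applies. *)
  have -> : (fun t => (if ui_val t <= 2^-1 then F (ui_clamp (2 * ui_val t + 0))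
      else F' (ui_clamp (2 * ui_val t + -1))) g : 'M[C]_n) =
    (fun t => if ui_val t <= 2^-1 then (F (ui_clamp (2 * ui_val t + 0)) g : 'M[C]_n)
      else (F' (ui_clamp (2 * ui_val t + -1)) g : 'M[C]_n)).
    by apply: funext => t; case: ifP.
  apply: continuous_paste; first exact: ui_val_continuous.
  + by apply: (@cont_clamp R _ _ (fun t => F t g : 'M[C]_n)) => //; exact: cont_ui_affine.
  + by apply: (@cont_clamp R _ _ (fun t => F' t g : 'M[C]_n)) => //; exact: cont_ui_affine.
  + move=> t ->; rewrite mulfV ?pnatr_eq0 // addr0 subrr.
    by rewrite -[ui_clamp 1]/(one : I) -[ui_clamp 0]/(zero : I) F1 F'0.
Qed.

(* In a basis adapted to [U], [rho] is block triangular; the path scales its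
   off-diagonal block by [1 - t]. *)
Lemma deform_to_split rho (U P : 'M[C]_n) :
  (forall x, stablemx U (rho x)) -> (P <= U)%MS ->
  (forall V : 'M[C]_n, (V <= U)%MS -> V *m P = V) ->
  exists2 sigma, deformable_to rho sigma &
    forall x, sigma x = GL_mx (rho x) - (1%:M - P) *m rho x *m P :> 'M[C]_n.
Proof.
move=> sU PU idP; have [Q QE] : exists Q, Q = 1%:M - P by exists (1%:M - P).
rewrite -QE.
have PP : P *m P = P by exact: idP.
have QP : Q *m P = 0 by rewrite QE mulmxBl mul1mx PP subrr.
have PQ : P *m Q = 0 by rewrite QE mulmxBr mulmx1 PP subrr.
have QDP : Q + P = 1%:M by rewrite QE subrK.
(* Invariance of [U] kills this block; the other off-diagonal block is [Q *m rho x *m P]. *)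
have PfQ x : P *m rho x *m Q = 0.
  rewrite QE mulmxBr mulmx1 idP ?subrr //.
  by apply: submx_trans (sU x); exact: submxMr.
pose f (t : C) x : 'M[C]_n := GL_mx (rho x) - t *: (Q *m rho x *m P).
have f1 t : f t 1%g = 1%:M by rewrite /f rep1 mulmx1 QP scaler0 subr0.
have fM t x y : f t (x * y)%g = f t x *m f t y.
  have QfQ y' : P *m rho y' = P *m rho y' *m P.
    by rewrite -[LHS]mulmx1 -QDP mulmxDr PfQ add0r.
  have mid : Q *m rho x *m P *m (Q *m rho y *m P) = 0.
    by rewrite !mulmxA -(mulmxA _ P Q) PQ mulmx0 !mul0mx.
  (* The off-diagonal block obeys the Leibniz rule, and by [mid] two such blocks multiply to 0; so
     [f t] is multiplicative for every [t]. *)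
  have cross : Q *m (rho x *m rho y) *m P =
      rho x *m (Q *m rho y *m P) + Q *m rho x *m P *m rho y.
    have -> : rho x *m (Q *m rho y *m P) = Q *m rho x *m Q *m rho y *m P.
      rewrite -{1}[GL_mx (rho x)]mul1mx -QDP mulmxDl mulmxDl.
      by rewrite [X in _ + X](_ : _ = 0) ?addr0 !mulmxA // PfQ !mul0mx.
    rewrite -[_ *m P *m rho y]mulmxA QfQ !mulmxA -!mulmxDl -!mulmxDr.
    by rewrite QDP mulmx1.
  rewrite /f repM mulmxBl !mulmxBr -!scalemxAr -!scalemxAl mid !scaler0 subr0.
  by rewrite cross scalerDr opprD addrA.
exists [the {multiplicative _ -> _} of GL_of (f1 1) (fM 1)]; last first.
  by move=> x; rewrite /= /f scale1r.
exists (fun t => [the {multiplicative _ -> _} of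
  GL_of (f1 (of_real (ui_val t))) (fM (of_real (ui_val t)))]); split.
- by move=> x; apply: val_inj; rewrite /= /f ui_val0 /of_real scale0r subr0.
- by move=> x; apply: val_inj; rewrite /= /f ui_val1.
- move=> x; rewrite /= /f.
  have := @affine_path_continuous R n (rho x) (- (Q *m rho x *m P)).
  by under eq_fun do rewrite scalerN.
Qed.

Lemma solvable_deform_commuting k rho :
  (forall x, derived k setT x -> rho x = 1%:M :> 'M[C]_n) ->
  exists (sigma : representation R G n) (N : set G),
    [/\ deformable_to rho sigma, is_subgroup N, fin_index N setT &
      forall x y, N x -> N y -> sigma x *m sigma y = sigma y *m sigma x].
Proof.
(* [U] is the part already treated, on which [N] acts by commuting matrices; [m] bounds its
   codimension. *)
suff: forall m rho (U : 'M[C]_n) (N : set G), (n - \rank U <= m)%N ->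
    (forall x, derived k setT x -> rho x = 1%:M :> 'M[C]_n) ->
    (forall x, stablemx U (rho x)) -> is_subgroup N -> fin_index N setT ->
    (forall x y, N x -> N y -> U *m (rho x *m rho y - rho y *m rho x) = 0) ->
  exists (sigma : representation R G n) (N : set G),
    [/\ deformable_to rho sigma, is_subgroup N, fin_index N setT &
      forall x y, N x -> N y -> sigma x *m sigma y = sigma y *m sigma x].
  move=> /(_ _ rho 0 setT (leqnn _)) H triv; apply: H => // [x||x y _ _].
  - exact: stable0mx.
  - exact: fin_index_refl.
  - by rewrite mul0mx.
elim=> [|m IH] {}rho U N rU triv sU NG NF UC.
all: have [fullU|nfullU] := boolP (row_full U).
1,3: exists rho, N; split=> // [|x y Nx Ny]; first exact: deformable_refl.
1,2: by apply/eqP; rewrite -subr_eq0; apply/eqP/(row_full_inj fullU);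
  rewrite mulmx0 UC.
  by move: nfullU; rewrite /row_full eqn_leq rank_leq_row -subn_eq0 -leqn0 rU.
(* The projection onto [U] along a complement, which is the row space of [1%:M - P]. *)
pose P := proj_mx U U^C%MS.
have PU : (P <= U)%MS by rewrite -[P]mul1mx proj_mx_sub.
have idP (V : 'M[C]_n) : (V <= U)%MS -> V *m P = V.
  exact/proj_mx_id/capmx_compl.
have [sigma rs sE] := deform_to_split sU PU idP.
have QP : (1%:M - P) *m P = 0 by rewrite mulmxBl mul1mx idP // subrr.
have UQ : U *m (1%:M - P) = 0 by rewrite mulmxBr mulmx1 idP // subrr.
have Us x : U *m sigma x = U *m rho x.
  by rewrite sE mulmxBr -!mulmxA !mulmxA UQ !mul0mx subr0.
have trivs x : derived k setT x -> sigma x = 1%:M :> 'M[C]_n.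
  by move=> /triv rx; rewrite sE rx mulmx1 QP subr0.
have QQ : (1%:M - P) *m (1%:M - P) = 1%:M - P.
  by rewrite [LHS]mulmxBr mulmx1 QP subr0.
have sQ x : stablemx (1%:M - P) (sigma x).
  rewrite sE (_ : _ *m _ = (1%:M - P) *m rho x *m (1%:M - P)) ?submxMl //.
  rewrite [LHS]mulmxBr [RHS]mulmxBr mulmx1; congr (_ - _).
  by rewrite !mulmxA QQ.
have Q0 : 1%:M - P != 0.
  apply: contraNneq nfullU => /eqP; rewrite subr_eq0 => /eqP P1.
  by rewrite -sub1mx P1.
have sT : hom_on setT (fun x => sigma x : 'M[C]_n).
  by split=> [|x y _ _]; [exact: rep1|exact: repM].
have [W [N' [W0 WQ sW [N'G N'F] WC]]] := solvable_commuting_subspace sT trivs Q0 sQ.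
have [tau [N'' [st N''G N''F tauC]]] : exists (tau : representation R G n) (N : set G),
    [/\ deformable_to sigma tau, is_subgroup N, fin_index N setT &
      forall x y, N x -> N y -> tau x *m tau y = tau y *m tau x].
  (* Commutation on [U] is inherited from [rho], which agrees with [sigma] there; on [W] it comes
     from [N']. *)
  apply: (IH sigma (U + W)%MS (N `&` N')) => //.
  - rewrite -ltnS; apply: leq_trans rU; apply: ltn_sub2l.
      by rewrite ltn_neqAle rank_leq_row andbT.
    apply: rank_ltmx; rewrite /ltmx addsmxSl /=.
    (* [1%:M - P] fixes [W] but vanishes on [U], so [W] inside [U] would be 0. *)
    apply: contraNN W0 => /(submx_trans (addsmxSr _ _)) WU.
    have [D WE] := submxP WQ.
    have : W *m (1%:M - P) = 0 by rewrite mulmxBr mulmx1 idP // subrr.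
    by rewrite {1}WE -mulmxA QQ -WE => ->.
  - move=> x; apply: stableDmx => //; rewrite Us; exact: sU.
  - case: NG N'G => N1 NM NV [N'1 N'M N'V].
    split=> [//|x y [Nx N'x] [Ny N'y]|x [Nx N'x]].
      by split; [exact: NM | exact: N'M].
    by split; [exact: NV | exact: N'V].
  - exact: fin_index_setI.
  - move=> x y [Nx N'x] [Ny N'y]; apply/sub_kermxP; rewrite addsmx_sub.
    apply/andP; split; apply/sub_kermxP; last exact: WC.
    have Uss x' y' : U *m (sigma x' *m sigma y') = U *m (rho x' *m rho y').
      rewrite !mulmxA Us; have [D ->] := submxP (sU x').
      by rewrite -!mulmxA Us.
    by rewrite mulmxBr !Uss -mulmxBr UC.
exists tau, N''; split=> //; exact: deformable_trans rs st.
Qed.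

End Deformation.

(** * Between a representation and its image *)

Lemma derived_image (G H : groupType) (f : {multiplicative G -> H}) k (A : set G) x :
  derived k A x -> derived k (f @` A) (f x).
Proof.
have f1 : f 1%g = 1%g by apply: (mulgI (f 1%g)); rewrite -gmulfM !mulg1.
have fV y : f y^-1%g = (f y)^-1%g.
  by apply: (mulgI (f y)); rewrite -gmulfM !mulgV.
elim: k x => [x Ax|k IH x] /=; first by exists x.
suff: derived k.+1 A `<=` f @^-1` (derived k.+1 (f @` A)) by apply.
have [D1 DM DV] := commutator_subgroup_group (derived k (f @` A)) (derived k (f @` A)).
apply: smallest_sub => [|_ [a Da [b Db <-]] /=].
  split=> [|a b /= Da Db|a /= Da] /=; rewrite ?f1 ?gmulfM ?fV //.
    exact: DM.
  exact: DV.
rewrite /commg /conjg !gmulfM !fV; apply: mem_commutator; exact: IH.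
Qed.

Lemma commuting_virtually_nilpotent (R : realType) (G : groupType) n
    (sigma : representation R G n) (N : set G) :
  is_subgroup N -> fin_index N setT ->
  (forall x y, N x -> N y -> sigma x *m sigma y = sigma y *m sigma x) ->
  virtually_nilpotent_rep sigma.
Proof.
move=> [N1 NM NV] NF comm.
have s1 : sigma 1%g = 1%g by apply: (mulgI (sigma 1%g)); rewrite -gmulfM !mulg1.
have sV y : sigma y^-1%g = (sigma y)^-1%g.
  by apply: (mulgI (sigma y)); rewrite -gmulfM !mulgV.
exists (sigma @` N); split.
- split=> [|_ _ [x Nx <-] [y Ny <-]|_ [x Nx <-]].
  + by exists 1%g.
  + by exists (x * y)%g; rewrite ?gmulfM //; exact: NM.
  + by exists x^-1%g; rewrite ?sV //; exact: NV.
- by move=> _ [x _ <-]; exists x.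
- have [s [_ sP]] := fin_index_reps NF.
  apply: (@sub_finite_set _ _ ((fun y => [set (sigma y^-1 * z)%g | z in sigma @` N])
             @` [set` s])); last by apply: finite_image; exact: finite_seq.
  (* [finite_index] counts left cosets and [fin_index] right ones: a representative [y] for the
     inverse of [x] yields the left coset of the inverse of [y]. *)
  move=> _ [_ [x _ <-] <-]; have [y ys Nxy] := sP x^-1%g I.
  exists y => //; apply/seteqP; split=> _ [_ [z Nz <-] <-].
    exists (sigma (x^-1 * y^-1 * z)%g).
      by exists (x^-1 * y^-1 * z)%g => //; exact: NM.
    by rewrite -!gmulfM !mulgA mulgV mul1g.
  exists (sigma (y * x * z)%g).
    exists (y * x * z)%g => //; apply: NM => //.
    by have := NV _ Nxy; rewrite invgM !invgK.
  by rewrite -!gmulfM !mulgA mulVg mul1g.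
(* The image of [N] is abelian, so one commutator step reaches the trivial group. *)
- exists 1%N; apply/seteqP; split=> [|_ ->].
    apply: smallest_sub.
      by split=> [//|_ _ -> ->|_ ->]; rewrite ?mulg1 ?invg1.
    move=> _ [_ [x Nx <-] [_ [y Ny <-] <-]] /=.
    apply/eqP/commgP; apply: val_inj; exact: comm.
  by case: (commutator_subgroup_group (sigma @` N) (sigma @` N)).
Qed.

Theorem theorem1p4 (R : realType) (d : nat) (X : complex_manifold R d) (x0 : X)
    (hX : compact_kahler X) (n : nat) (Gamma : set (GL (Cplx R) n))
    (hGamma : is_subgroup Gamma) (hsolv : is_solvable Gamma)
    (rho : representation R (fundamental_group R x0) n)
    (hrho : range rho = Gamma) :
  (exists sigma : representation R (fundamental_group R x0) n,
     deformable_to rho sigma /\ virtually_nilpotent_rep sigma) \/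
  (exists (Y : complex_manifold R 1) (y0 : Y),
     [/\ is_curve Y,
         exists g : nat, has_genus Y g /\ (0 < g)%N
       & exists f : {multiplicative fundamental_group R x0 -> fundamental_group R y0},
           range f = setT]).
Proof.
have [k Gammak] := hsolv; left.
(* [rho] maps the derived series of the fundamental group into that of [Gamma], which is trivial at
   step [k]. *)
have triv x : derived k setT x -> rho x = 1%:M :> 'M[Cplx R]_n.
  move=> /(derived_image rho); rewrite hrho.
  by rewrite /derived Gammak => ->.
have [sigma [N [rs NG NF comm]]] := solvable_deform_commuting triv.
by exists sigma; split=> //; exact: commuting_virtually_nilpotent NG NF comm.
Qed.
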